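(* Let $\Lambda$ be a unimodular Gauss lattice in $\mathbb C^2$ and let $u=(u_1,u_2)$, $v=(v_1,v_2)$ be two consecutive minimal vectors of $\Lambda$ with $|u_2|<|v_2|$. Let $w_1=\tfrac{v_1}{u_1}$ and $w_2=\tfrac{u_2}{v_2}$. If $w_1\neq0$, then there exists a minimal vector $v'\in\Lambda$ such that $v$ and $v'$ are consecutive minimal vectors, and: \begin{itemize} \item If $\det_{\mathbb C}(u,v)=1$, then $v'$ is any vector that is minimal for the preorder $\prec$ in the set \[E_1=\{z=-au+gv:\ a\in\{1,1+i\},\ g\in\mathbb Z[i],\ |\tfrac{a}{w_1}-g|<1\}.\] Moreover, writing $u'=v=(u_1',v_2'w_2')$ and $v'=-au+gv=(u_1'w_1',v_2')$, one has $w_1'=g-\tfrac{a}{w_1}$ and $w_2'=\tfrac{1}{g-aw_2}$. \item If $\det_{\mathbb C}(u,v)=1+i$, then $v'$ is any vector that is minimal for the preorder $\prec$ in the set \[E_2=\{z=-\tfrac{1}{1+i}(u+v)+gv:\ g\in\mathbb Z[i],\ |\tfrac{1}{(1+i)w_1}+\tfrac{1}{1+i}-g|<1\}.\] Moreover, writing $u'=v=(u_1',v_2'w_2')$ and $v'=-\tfrac{1}{1+i}(u+v)+gv=(u_1'w_1',v_2')$, one has $w_1'=g-\tfrac{1}{(1+i)w_1}-\tfrac{1}{1+i}$ and $w_2'=\dfrac{1}{g-\tfrac{1}{1+i}w_2-\tfrac{1}{1+i}}$. \end{itemize}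
   Context: A Gauss lattice in $\mathbb C^2$ is a discrete $\mathbb Z[i]$-submodule spanning $\mathbb C^2$; it is unimodular if it has a $\mathbb Z[i]$-basis whose complex determinant lies in $\{\pm1,\pm i\}$. For $u=(u_1,u_2)$ let $C(u)=\{(z_1,z_2):|z_1|\le|u_1|,|z_2|\le|u_2|\}$; a nonzero $u\in\Lambda$ is minimal if every nonzero $z\in\Lambda\cap C(u)$ has $|z_1|=|u_1|$ and $|z_2|=|u_2|$. Minimal vectors $u,v$ are consecutive if $|u_2|<|v_2|$ and no minimal vector $w$ has $|u_2|<|w_2|<|v_2|$. The lexicographic preorder on $\mathbb C^2$: $(x_1,x_2)\prec(y_1,y_2)$ iff $|x_2|<|y_2|$, or $|x_2|=|y_2|$ and $|x_1|\le|y_1|$. $\det_{\mathbb C}(u,v)=u_1v_2-u_2v_1$. *)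

(* Defs.v *)
From mathcomp Require Export all_boot all_order all_algebra.
From mathcomp Require Export complex.
From mathcomp Require Export classical_sets reals.
Set Implicit Arguments.
Unset Strict Implicit.
Unset Printing Implicit Defensive.
Export Order.TTheory GRing.Theory Num.Theory.
Local Open Scope ring_scope.

(* A vector z = (z_1, z_2) of C^2 is a row vector: z_1 = z 0 0, z_2 = z 0 1.
   In R[i], `|x| is a nonnegative real element of R[i], so moduli are compared
   with the (partial) order of R[i]. *)

Definition gauss_int (R : realType) (g : R[i]) : Prop :=
  exists m n : int, g = m%:~R + n%:~R * 'i.

Definition gauss_submodule (R : realType) (L : set 'rV[R[i]]_2) : Prop :=
  [/\ L 0,
      forall x y, L x -> L y -> L (x + y) &
      forall g x, gauss_int g -> L x -> L (g *: x)].

(* Every point of L is isolated in L, for the product topology. *)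
Definition discrete_subset (R : realType) (L : set 'rV[R[i]]_2) : Prop :=
  forall x, L x -> exists2 e : R, 0 < e &
    forall y, L y -> `|y 0 0 - x 0 0| < e%:C%C -> `|y 0 1 - x 0 1| < e%:C%C ->
      y = x.

(* <<s>> is the C-linear span; for a Z[i]-submodule the R-linear span is the
   same subspace. *)
Definition spanning (R : realType) (L : set 'rV[R[i]]_2) : Prop :=
  exists2 s : seq 'rV[R[i]]_2, (forall z, z \in s -> L z) & <<s>>%VS = fullv.

Definition gauss_lattice (R : realType) (L : set 'rV[R[i]]_2) : Prop :=
  [/\ gauss_submodule L, discrete_subset L & spanning L].

Definition gauss_basis (R : realType) (L : set 'rV[R[i]]_2)
    (e1 e2 : 'rV[R[i]]_2) : Prop :=
  [/\ L e1, L e2,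
      forall z, L z -> exists a b : R[i],
        [/\ gauss_int a, gauss_int b & z = a *: e1 + b *: e2] &
      forall a b : R[i], gauss_int a -> gauss_int b ->
        a *: e1 + b *: e2 = 0 -> a = 0 /\ b = 0].

Definition detC (R : realType) (u v : 'rV[R[i]]_2) : R[i] :=
  u 0 0 * v 0 1 - u 0 1 * v 0 0.

Definition unimodular_gauss_lattice (R : realType)
    (L : set 'rV[R[i]]_2) : Prop :=
  gauss_lattice L /\
  exists e1 e2, gauss_basis L e1 e2 /\
    [\/ detC e1 e2 = 1, detC e1 e2 = -1, detC e1 e2 = 'i | detC e1 e2 = - 'i].

Definition cylinder (R : realType) (u : 'rV[R[i]]_2) : set 'rV[R[i]]_2 :=
  [set z | `|z 0 0| <= `|u 0 0| /\ `|z 0 1| <= `|u 0 1|]%classic.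

Definition minimal_vector (R : realType) (L : set 'rV[R[i]]_2)
    (u : 'rV[R[i]]_2) : Prop :=
  [/\ L u, u <> 0 &
      forall z, L z -> z <> 0 -> cylinder u z ->
        `|z 0 0| = `|u 0 0| /\ `|z 0 1| = `|u 0 1|].

Definition consecutive (R : realType) (L : set 'rV[R[i]]_2)
    (u v : 'rV[R[i]]_2) : Prop :=
  [/\ minimal_vector L u, minimal_vector L v, `|u 0 1| < `|v 0 1| &
      ~ exists w, [/\ minimal_vector L w, `|u 0 1| < `|w 0 1| &
                      `|w 0 1| < `|v 0 1|]].

Definition lex_prec (R : realType) (x y : 'rV[R[i]]_2) : Prop :=
  `|x 0 1| < `|y 0 1| \/ (`|x 0 1| = `|y 0 1| /\ `|x 0 0| <= `|y 0 0|).

Definition lex_minimal (R : realType) (E : set 'rV[R[i]]_2)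
    (m : 'rV[R[i]]_2) : Prop :=
  E m /\ forall z, E z -> lex_prec z m -> lex_prec m z.

Definition E1_param (R : realType) (w1 a g : R[i]) : Prop :=
  [/\ a = 1 \/ a = 1 + 'i, gauss_int g & `|a / w1 - g| < 1].

Definition E1_vec (R : realType) (u v : 'rV[R[i]]_2) (a g : R[i]) :
  'rV[R[i]]_2 := - a *: u + g *: v.

Definition E1 (R : realType) (u v : 'rV[R[i]]_2) (w1 : R[i]) :
    set 'rV[R[i]]_2 :=
  [set z | exists a g, E1_param w1 a g /\ z = E1_vec u v a g]%classic.

Definition E2_param (R : realType) (w1 g : R[i]) : Prop :=
  gauss_int g /\
  `|1 / ((1 + 'i) * w1) + 1 / (1 + 'i) - g| < 1.

Definition E2_vec (R : realType) (u v : 'rV[R[i]]_2) (g : R[i]) :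
  'rV[R[i]]_2 := - (1 / (1 + 'i)) *: (u + v) + g *: v.

Definition E2 (R : realType) (u v : 'rV[R[i]]_2) (w1 : R[i]) :
    set 'rV[R[i]]_2 :=
  [set z | exists g, E2_param w1 g /\ z = E2_vec u v g]%classic.

(* (u, v) has the form u = (u_1, v_2 w_2), v = (u_1 w_1, v_2). *)
Definition pair_form (R : realType) (u v : 'rV[R[i]]_2) (w1 w2 : R[i]) : Prop :=
  v 0 0 = u 0 0 * w1 /\ u 0 1 = v 0 1 * w2.

(* Main.v *)
Require Import Defs.
From mathcomp Require Import zify ring lra.
From mathcomp Require Import boolp.
Set Implicit Arguments.
Unset Strict Implicit.
Unset Printing Implicit Defensive.
Local Open Scope ring_scope.

(** The minimal vector after v is the lexicographic minimum s of the nonzero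
    lattice vectors z with |z_1| < |v_1|.  Complete v by t to a basis with
    det(v, t) = 1 and write s = c v + d t.  Hermite's bound for binary forms
    over Z[i], applied to the pairs (k, j d - k c), yields |d|^2 <= 2, for
    otherwise some k t + j v would precede s.  If det(u, v) = 1 take t = - u:
    up to a unit, s lies in E_1.  If det(u, v) = 1 + i then (u + v) / (1 + i)
    is a lattice vector, and take t to be its opposite: if |d| = 1 then, up to a
    unit, s lies in E_2; if |d|^2 = 2 then s = - u + e v with e even, and some
    (- u + h v) / (1 + i) with h odd adjacent to e precedes or ties s. *)

Local Notation Re := complex.Re.
Local Notation Im := complex.Im.

(** * Squared moduli and Gaussian integers *)

Section SquaredModulus.
Variable R : realType.
Implicit Types (x y z g : R[i]) (m n : int).

(** Moduli live in [R[i]], whose order is only partial; their squares in [R] bring every comparison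
    within reach of real arithmetic. *)
Definition sqn z : R := Re z ^+ 2 + Im z ^+ 2.

Lemma ReD x y : Re (x + y) = Re x + Re y. Proof. by case: x; case: y. Qed.
Lemma ImD x y : Im (x + y) = Im x + Im y. Proof. by case: x; case: y. Qed.
Lemma ReN x : Re (- x) = - Re x. Proof. by case: x. Qed.
Lemma ImN x : Im (- x) = - Im x. Proof. by case: x. Qed.
Lemma ReM x y : Re (x * y) = Re x * Re y - Im x * Im y.
Proof. by case: x; case: y. Qed.
Lemma ImM x y : Im (x * y) = Re x * Im y + Im x * Re y.
Proof. by case: x => a b; case: y => c d /=; ring. Qed.
Lemma Re1 : Re (1 : R[i]) = 1. Proof. by []. Qed.
Lemma Im1 : Im (1 : R[i]) = 0. Proof. by []. Qed.
Lemma Re_i : Re ('i : R[i]) = 0. Proof. by rewrite -complexiE. Qed.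
Lemma Im_i : Im ('i : R[i]) = 1. Proof. by rewrite -complexiE. Qed.
Lemma Re_conj x : Re (conjc x) = Re x. Proof. by case: x. Qed.
Lemma Im_conj x : Im (conjc x) = - Im x. Proof. by case: x. Qed.

Definition ReImE := (ReD, ImD, ReN, ImN, ReM, ImM, Re1, Im1, Re_i, Im_i,
  Re_conj, Im_conj).

Lemma complex_eqP x y : Re x = Re y -> Im x = Im y -> x = y.
Proof. by case: x => a b; case: y => c d /= -> ->. Qed.

Lemma sqnM x y : sqn (x * y) = sqn x * sqn y.
Proof. by rewrite /sqn !ReImE; ring. Qed.
Lemma sqnN x : sqn (- x) = sqn x.
Proof. by rewrite /sqn !ReImE; ring. Qed.
Lemma sqn_ge0 x : 0 <= sqn x.
Proof. by rewrite /sqn addr_ge0 ?sqr_ge0. Qed.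
Lemma sqn0 : sqn 0 = 0. Proof. by rewrite /sqn /=; ring. Qed.
Lemma sqn1 : sqn 1 = 1. Proof. by rewrite /sqn /=; ring. Qed.
Lemma sqn_norm x : (sqn x)%:C%C = `|x| ^+ 2.
Proof. exact: add_Re2_Im2. Qed.

Lemma normc_le x y : (`|x| <= `|y|) = (sqn x <= sqn y).
Proof. by rewrite -lecR !sqn_norm ler_pXn2r ?nnegrE. Qed.
Lemma normc_lt x y : (`|x| < `|y|) = (sqn x < sqn y).
Proof. by rewrite -ltcR !sqn_norm ltr_pXn2r ?nnegrE. Qed.
Lemma normc_lt1 x : (`|x| < 1) = (sqn x < 1).
Proof. by rewrite -(normr1 R[i]) normc_lt sqn1. Qed.
Lemma normc_eq x y : `|x| = `|y| <-> sqn x = sqn y.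
Proof.
split=> [h|h]; first by apply: (@complexI R); rewrite !sqn_norm h.
by apply/eqP; rewrite eq_le !normc_le h lexx.
Qed.

Lemma sqn_eq0 x : (sqn x == 0) = (x == 0).
Proof.
apply/eqP/eqP => [|->]; last exact: sqn0.
by rewrite -sqn0 -normc_eq normr0 => /normr0_eq0.
Qed.
Lemma sqn_gt0 x : (0 < sqn x) = (x != 0).
Proof. by rewrite lt_def sqn_eq0 sqn_ge0 andbT. Qed.

Lemma sqn_mul_lt x y : y != 0 -> (sqn (x * y) < sqn y) = (sqn x < 1).
Proof. by rewrite -sqn_gt0 => y0; rewrite sqnM -[X in _ < X]mul1r ltr_pM2r. Qed.

(** The defect is itself a squared modulus, by Lagrange's identity. *)
Lemma cauchy_schwarz x y z t :
  sqn (x * z + y * t) <= (sqn x + sqn y) * (sqn z + sqn t).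
Proof.
suff -> : (sqn x + sqn y) * (sqn z + sqn t) = sqn (x * z + y * t)
    + sqn (x * conjc t - y * conjc z) by rewrite lerDl sqn_ge0.
by rewrite /sqn !ReImE; ring.
Qed.

Lemma gauss_intE g : gauss_int g <-> exists m n, Re g = m%:~R /\ Im g = n%:~R.
Proof.
have intC m : (m%:~R : R[i]) = (m%:~R : R)%:C%C by rewrite rmorph_int.
split=> [[m [n ->]]|[m [n [hm hn]]]]; exists m, n.
  by rewrite !ReImE !intC /=; split; ring.
by apply: complex_eqP; rewrite !ReImE !intC /= ?hm ?hn; ring.
Qed.

Lemma gauss_intD x y : gauss_int x -> gauss_int y -> gauss_int (x + y).
Proof.
move=> /gauss_intE[m [n [h1 h2]]] /gauss_intE[p [q [h3 h4]]].
by apply/gauss_intE; exists (m + p), (n + q); rewrite !ReImE !rmorphD h1 h2 h3 h4.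
Qed.
Lemma gauss_intN x : gauss_int x -> gauss_int (- x).
Proof.
move=> /gauss_intE[m [n [h1 h2]]].
by apply/gauss_intE; exists (- m), (- n); rewrite !ReImE !rmorphN h1 h2.
Qed.
Lemma gauss_intB x y : gauss_int x -> gauss_int y -> gauss_int (x - y).
Proof. by move=> hx hy; apply/gauss_intD/gauss_intN. Qed.
Lemma gauss_intM x y : gauss_int x -> gauss_int y -> gauss_int (x * y).
Proof.
move=> /gauss_intE[m [n [h1 h2]]] /gauss_intE[p [q [h3 h4]]].
apply/gauss_intE; exists (m * p - n * q), (m * q + n * p).
by rewrite !ReImE h1 h2 h3 h4 !rmorphB !rmorphD !rmorphM /=.
Qed.
Lemma gauss_int_conj x : gauss_int x -> gauss_int (conjc x).
Proof.
move=> /gauss_intE[m [n [h1 h2]]].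
by apply/gauss_intE; exists m, (- n); rewrite !ReImE !rmorphN h1 h2.
Qed.
Lemma gauss_int_int m : gauss_int (m%:~R : R[i]).
Proof. by exists m, 0; rewrite mul0r addr0. Qed.
Lemma gauss_int0 : gauss_int (0 : R[i]). Proof. exact: (gauss_int_int 0). Qed.
Lemma gauss_int1 : gauss_int (1 : R[i]). Proof. exact: (gauss_int_int 1). Qed.
Lemma gauss_int_i : gauss_int ('i : R[i]).
Proof. by exists 0, 1; rewrite mul1r add0r. Qed.

Lemma sqn_gauss x : gauss_int x -> exists n : nat, sqn x = n%:R.
Proof.
move=> /gauss_intE[m [n [h1 h2]]]; exists (`|m| ^ 2 + `|n| ^ 2)%N.
rewrite /sqn h1 h2 natrD !natrX !natr_absz.
by rewrite !intr_norm !real_normK ?num_real.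
Qed.

Lemma gauss_small x : gauss_int x -> sqn x < 1 -> x = 0.
Proof.
move=> /sqn_gauss[n hn]; rewrite hn ltrn1 ltnS leqn0 => /eqP n0.
by apply/eqP; rewrite -sqn_eq0 hn n0.
Qed.

Lemma round_real (r : R) : exists m : int, (r - m%:~R) ^+ 2 <= 1 / 4.
Proof.
exists (Num.floor (r + 1 / 2)).
have /andP[] := floor_itv (r + 1 / 2); rewrite rmorphD /=.
set m := _%:~R; nra.
Qed.

Lemma gauss_round x : exists2 g, gauss_int g & sqn (x - g) <= 1 / 2.
Proof.
have [m hm] := round_real (Re x); have [n hn] := round_real (Im x).
exists (m%:~R +i* n%:~R)%C; first by apply/gauss_intE; exists m, n.
by rewrite /sqn !ReImE /=; lra.
Qed.

(** Centred division. For odd N the bound [N./2] is sharper than N / 2, and [gauss_reduction] needs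
    this at N = 3. *)
Lemma round_int m (N : nat) : (0 < N)%N ->
  exists q : int, ((m - q * N%:Z) ^+ 2 <= (N./2 ^ 2)%N%:Z).
Proof.
move=> N0; pose h := (N./2)%:Z; exists ((m + h) %/ N%:Z)%Z.
have := divz_eq (m + h) N%:Z; have := modz_ge0 (m + h) (_ : N%:Z != 0).
have := ltz_pmod (m + h) (_ : 0 < N%:Z).
set q := (_ %/ _)%Z; set r := (_ %% _)%Z => /(_ ltac:(lia)) h1 /(_ ltac:(lia)) h2 h3.
have -> : m - q * N%:Z = r - h by lia.
have : - h <= r - h <= h by rewrite /h; lia.
rewrite (_ : (_ ^ 2)%N%:Z = h * h); last by rewrite /h; nia.
by move: (r - h) => s; nia.
Qed.

Lemma gauss_round_int x (N : nat) : gauss_int x -> (0 < N)%N ->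
  exists2 g, gauss_int g & sqn (x - g * N%:R) <= (2 * N./2 ^ 2)%:R.
Proof.
move=> /gauss_intE[m [n [h1 h2]]] N0.
have [p hp] := round_int m N0; have [q hq] := round_int n N0.
exists (p%:~R +i* q%:~R)%C; first by apply/gauss_intE; exists p, q.
have NC : (N%:R : R[i]) = (N%:R : R)%:C%C by rewrite rmorph_nat.
rewrite /sqn !ReImE NC h1 h2 /=.
move: hp hq; rewrite -!(ler_int R) !rmorphXn !rmorphB !rmorphM /= => hp hq.
rewrite natrM !mulr0 subr0 add0r.
have -> : (N./2 ^ 2)%:R = ((N./2 ^ 2)%N%:Z)%:~R :> R by [].
by lra.
Qed.

End SquaredModulus.

(** * Hermite's bound over Z[i] *)

Section Reduction.
Variable R : realType.
Implicit Types (c d k j g : R[i]).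

(** The Gram determinant of two vectors of C^2 is the squared modulus of their determinant. *)
Lemma lagrange_identity (x y z t : R[i]) :
  sqn (z * conjc x + t * conjc y) + sqn (x * t - y * z)
    = (sqn x + sqn y) * (sqn z + sqn t).
Proof. by rewrite /sqn !ReImE; ring. Qed.

(* Gauss reduction: among the bases of the Z[i]-module of pairs (k, j d - k c),
   whose determinant is d, take one whose first vector has least norm N and
   reduce the second vector modulo the first. *)
Lemma gauss_reduction c d : gauss_int c -> gauss_int d -> 4 <= sqn d ->
  exists k j, [/\ gauss_int k, gauss_int j, 0 < sqn k + sqn (j * d - k * c)
    & 2 * (sqn k + sqn (j * d - k * c)) <= sqn d].
Proof.
move=> hc hd d4.
pose P n := exists k j k' j', [/\ gauss_int k, gauss_int j, gauss_int k' & gauss_int j']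
  /\ k * j' - k' * j = 1 /\ sqn k + sqn (j * d - k * c) = n%:R.
have sqnG k j : gauss_int k -> gauss_int j ->
    exists n : nat, sqn k + sqn (j * d - k * c) = n%:R.
  move=> hk hj; have [n1 ->] := sqn_gauss hk.
  have [|n2 ->] := @sqn_gauss R (j * d - k * c).
    by apply: gauss_intB; apply: gauss_intM.
  by exists (n1 + n2)%N; rewrite natrD.
have exP : exists n, `[< P n >].
  have [n hn] := sqnG 1 0 (gauss_int1 R) (gauss_int0 R).
  exists n; apply/asboolP; exists 1, 0, 0, 1; split; last by split=> //; ring.
  by split; [exact: gauss_int1|exact: gauss_int0|exact: gauss_int0|exact: gauss_int1].
have [N /asboolP[k [j [k' [j' [[hk hj hk' hj'] [det1 hN]]]]]] Nmin] := ex_minnP exP.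
have d0 : d != 0 by rewrite -sqn_gt0; lra.
have N0 : (0 < N)%N.
  rewrite lt0n; apply/eqP => N0; move: hN; rewrite N0 => h0.
  have := sqn_ge0 k; have := sqn_ge0 (j * d - k * c) => h1 h2.
  have /eqP : sqn k = 0 by lra.
  have /eqP : sqn (j * d - k * c) = 0 by lra.
  rewrite !sqn_eq0 => /eqP yE /eqP k0; move: yE; rewrite k0 mul0r subr0 => /eqP.
  rewrite mulf_eq0 (negPf d0) orbF => /eqP j0.
  by move: det1 => /eqP; rewrite k0 j0 mul0r mulr0 subr0 eq_sym oner_eq0.
exists k, j; split=> //; first by rewrite hN ltr0n.
pose y := j * d - k * c; pose y' := j' * d - k' * c.
(* [h] is the Hermitian product of the second basis vector with the first; rounding h / N to [g]
   tells which multiple of the first to subtract from the second. *)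
pose h := k' * conjc k + y' * conjc y.
have hh : gauss_int h.
  by rewrite /h /y /y'; apply: gauss_intD; apply: gauss_intM => //;
    do ?[apply: gauss_int_conj]; rewrite //; apply: gauss_intB; apply: gauss_intM.
have [g hg hp] := gauss_round_int hh N0.
have sqnC x : x * conjc x = ((sqn x)%:C%C : R[i]).
  by apply: complex_eqP; rewrite !ReImE /sqn /=; ring.
have [N2 hN2] : exists n : nat, sqn (k' - g * k) + sqn (y' - g * y) = n%:R.
  have [||n hn] := sqnG (k' - g * k) (j' - g * j).
  - by apply: gauss_intB => //; apply: gauss_intM.
  - by apply: gauss_intB => //; apply: gauss_intM.
  by exists n; rewrite -hn; congr (_ + sqn _); rewrite /y /y'; ring.
(* The reduced second vector, negated, followed by the first, is again a basis of determinant 1, so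
   [N] is at most its norm. *)
have NN2 : (N <= N2)%N.
  apply: Nmin; apply/asboolP; exists (- (k' - g * k)), (- (j' - g * j)), k, j.
  split; first by split=> //; apply: gauss_intN; apply: gauss_intB => //; apply: gauss_intM.
  split; first by rewrite -det1; ring.
  rewrite -hN2 sqnN -[in RHS](sqnN (y' - _)); congr (_ + sqn _).
  by rewrite /y /y'; ring.
have := lagrange_identity k y (k' - g * k) (y' - g * y).
have -> : (k' - g * k) * conjc k + (y' - g * y) * conjc y = h - g * N%:R.
  have -> : (N%:R : R[i]) = k * conjc k + y * conjc y.
    by rewrite !sqnC -rmorphD /= hN rmorph_nat.
  by rewrite /h; ring.
have -> : k * (y' - g * y) - y * (k' - g * k) = d.
  by rewrite -[RHS]mul1r -det1 /y /y'; ring.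
rewrite hN hN2; have [D hD] := sqn_gauss hd.
move: hp; rewrite hD; move: d4; rewrite hD (ler_nat _ 4) => d4.
move=> hp hE; have : N%:R * N2%:R <= (2 * N./2 ^ 2 + D)%:R :> R.
  by rewrite natrD -hE lerD2r.
rewrite -!natrM !ler_nat => {}hE.
have hE2 : (N * N <= 2 * N./2 ^ 2 + D)%N.
  by apply: leq_trans hE; rewrite leq_mul2l NN2 orbT.
suff : (2 * N <= D)%N by [].
(* For N <= 2 the hypothesis D >= 4 is enough; for larger N the inequality [hE2] gives the claim,
   with N = 3 relying on the integer half [N./2]. *)
have [N3|N3] := leqP N 2; first by lia.
have := odd_double_half N; set b := (odd N : nat); set m := N./2 in hE2 *.
have : (b <= 1)%N by rewrite /b; case: odd.
move: hE2 N3 d4; clearbody b m; clear; rewrite -muln2.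
by case: b => [|[|//]] *; subst; nia.
Qed.

End Reduction.

(** * Plane geometry of Gaussian integers by parity *)

Section OddPoint.
Variable R : realType.
Implicit Types (x y s t : R) (m n p q : int).

Definition dist2 m n x y : R := (m%:~R - x) ^+ 2 + (n%:~R - y) ^+ 2.
(** This is the condition for 1 + i to divide 1 + m + n i, that is, for (- u + (m + n i) v) / (1 +
    i) to differ from - (u + v) / (1 + i) by a Gaussian multiple of v. *)
Definition odd_point m n := exists k : int, m + n = 2 * k + 1.

(* [(x, y)] and [(s, t)] stand for u_1 / v_1 and u_2 / v_2, and [(m, n)] for the
   vector (- u + (m + n i) v) / (1 + i): minimality of v yields the first clause,
   consecutiveness of u and v the second. *)
Definition odd_separated x y s t := forall m n, odd_point m n ->
  (dist2 m n x y < 2 -> 2 < dist2 m n s t) /\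
  (dist2 m n x y < 2 * (x ^+ 2 + y ^+ 2) -> 2 <= dist2 m n s t).

(** Here (p, q) stands for - u + (p + q i) v. The vector of (m, n) has first coordinate smaller than
    that of v and lexicographically precedes or ties the one of (p, q); the factors 2 are |1 +
    i|^2. *)
Definition odd_improvement x y s t p q := exists m n,
  [/\ odd_point m n, dist2 m n x y < 2 &
   dist2 m n s t < 2 * dist2 p q s t \/
   (dist2 m n s t = 2 * dist2 p q s t /\ dist2 m n x y <= 2 * dist2 p q x y)].

(** Reflections in an axis or in the diagonal preserve distances and the parity of m + n; they serve
    to move (x, y) into the first quadrant. *)
Lemma odd_improvement_flip1 x y s t p q :
  odd_improvement (- x) y (- s) t (- p) q -> odd_improvement x y s t p q.
Proof.
have flip m n x0 y0 : dist2 (- m) n (- x0) y0 = dist2 m n x0 y0.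
  by rewrite /dist2 rmorphN /=; ring.
move=> [m [n [[k ho] h1 h2]]]; exists (- m), n.
split; first by exists (n - k - 1); lia.
  by rewrite -[x]opprK flip.
by move: h2; rewrite -(flip (- m)) -(flip (- m) n x) opprK !flip.
Qed.

Lemma odd_separated_flip1 x y s t :
  odd_separated x y s t -> odd_separated (- x) y (- s) t.
Proof.
have flip m n x0 y0 : dist2 m n (- x0) y0 = dist2 (- m) n x0 y0.
  by rewrite /dist2 rmorphN /=; ring.
move=> h m n [k ho]; rewrite !flip sqrrN; apply: h.
by exists (n - k - 1); lia.
Qed.

Lemma odd_improvement_swap x y s t p q :
  odd_improvement y x t s q p -> odd_improvement x y s t p q.
Proof.
have flip m n x0 y0 : dist2 m n x0 y0 = dist2 n m y0 x0 by rewrite /dist2 addrC.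
move=> [m [n [[k ho] h1 h2]]]; exists n, m.
split; first by exists k; rewrite addrC.
  by rewrite flip.
by rewrite !(flip n) !(flip p).
Qed.

Lemma odd_separated_swap x y s t :
  odd_separated x y s t -> odd_separated y x t s.
Proof.
have flip m n x0 y0 : dist2 m n x0 y0 = dist2 n m y0 x0 by rewrite /dist2 addrC.
move=> h m n [k ho]; rewrite !(flip m) addrC addrC; have := h n m.
rewrite [x ^+ 2 + _]addrC; apply.
by exists k; rewrite addrC.
Qed.

Lemma sqr_le2 x y : 0 <= x -> x <= y -> x ^+ 2 <= y ^+ 2.
Proof. by move=> x0 xy; rewrite ler_pXn2r ?nnegrE //; lra. Qed.

(* By the parallelogram law the neighbours [p + 1] and [p - 1] of [p] satisfy
   [par] below, so separation of [p - 1] bounds [p + 1]. *)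
Lemma odd_improvement_step x y s t p q :
  odd_separated x y s t -> 0 <= x -> 0 <= y -> s < 0 -> t < 0 ->
  2 <= dist2 1 0 s t -> 2 <= dist2 0 1 s t ->
  (exists k : int, p + q = 2 * k) -> 1 <= p -> 0 <= q ->
  dist2 p q x y < 1 -> p%:~R < x -> odd_improvement x y s t p q.
Proof.
move=> hsep x0 y0 s0 t0 h10 h01 [k hk] hp hq hd px.
exists (p + 1), q; split; first by exists k; lia.
  by move: hd; rewrite /dist2 rmorphD /=; nra.
have par x1 y1 : dist2 (p + 1) q x1 y1 = 2 * dist2 p q x1 y1 + 2
    - dist2 (p - 1) q x1 y1.
  by rewrite /dist2 rmorphD rmorphB /=; ring.
have ho : odd_point (p - 1) q by exists (k - 1); lia.
have [hA _] := hsep _ _ ho.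
(* An odd point of the closed first quadrant other than (0, 1) and (1, 0) has a coordinate at least
   2 or both at least 1, while s and t are negative. *)
have : 2 <= dist2 (p - 1) q s t.
  have [e1|e1] := eqVneq (p - 1) 0.
    have [e2|e2] := eqVneq q 1; first by rewrite e1 e2.
    have h : (2 : int)%:~R <= q%:~R :> R by rewrite ler_int; clear -hq hk e1 e2; lia.
    have h4 : 2 ^+ 2 <= (q%:~R - t) ^+ 2 by apply: sqr_le2; lra.
    by have := sqr_ge0 ((p - 1)%:~R - s); rewrite /dist2; lra.
  have [e2|e2] := eqVneq q 0.
    have [e3|e3] := eqVneq (p - 1) 1; first by rewrite e3 e2.
    have h : (2 : int)%:~R <= (p - 1)%:~R :> R by rewrite ler_int; clear -hp hk e1 e2 e3; lia.
    have h4 : 2 ^+ 2 <= ((p - 1)%:~R - s) ^+ 2 by apply: sqr_le2; lra.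
    by have := sqr_ge0 (q%:~R - t); rewrite /dist2; lra.
  have h : (1 : int)%:~R <= (p - 1)%:~R :> R by rewrite ler_int; clear -hp e1; lia.
  have h' : (1 : int)%:~R <= q%:~R :> R by rewrite ler_int; clear -hq e2; lia.
  have h1 : 1 ^+ 2 <= ((p - 1)%:~R - s) ^+ 2 by apply: sqr_le2; lra.
  have h2 : 1 ^+ 2 <= (q%:~R - t) ^+ 2 by apply: sqr_le2; lra.
  by rewrite /dist2; lra.
(* At equality the second coordinates tie; the first clause of separation then keeps (p - 1, q) away
   from (x, y) too, and [par] compares the first coordinates. *)
rewrite le_eqVlt => /orP[/eqP e|h]; last by left; rewrite par; lra.
have : 2 <= dist2 (p - 1) q x y by rewrite leNgt; apply/negP => /hA; rewrite -e ltxx.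
by right; rewrite !par; split; lra.
Qed.

(** Separation at (1, 0) and (0, 1) pushes (s, t) into the open negative quadrant, whereas (p, q)
    lies in the closed positive one. If p or q can be decreased towards (x, y), this also gains on
    (s, t); otherwise [odd_improvement_step] increases one of them. *)
Lemma odd_improvement_pos x y s t p q :
  0 <= x -> 0 <= y -> 1 < x ^+ 2 + y ^+ 2 -> s ^+ 2 + t ^+ 2 < 1 ->
  odd_separated x y s t -> (exists k : int, p + q = 2 * k) ->
  dist2 p q x y < 1 -> odd_improvement x y s t p q.
Proof.
move=> x0 y0 hxy hst hsep heven hd; have [k hk] := heven.
have ho10 : odd_point 1 0 by exists 0.
have ho01 : odd_point 0 1 by exists 0.
(* The second clause applies because (1 - x)^2 + y^2 <= 1 + x^2 + y^2 < 2 (x^2 + y^2). *)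
have h10 : 2 <= dist2 1 0 s t.
  by apply: (hsep _ _ ho10).2; rewrite /dist2 /=; nra.
have h01 : 2 <= dist2 0 1 s t.
  by apply: (hsep _ _ ho01).2; rewrite /dist2 /=; nra.
have s0 : s < 0 by move: h10; rewrite /dist2 /=; nra.
have t0 : t < 0 by move: h01; rewrite /dist2 /=; nra.
have p0 : 0 <= p.
  rewrite leNgt; apply/negP => p0.
  have h : p%:~R <= (-1 : int)%:~R :> R by rewrite ler_int; clear -p0; lia.
  have h1 : 1 ^+ 2 <= (x - p%:~R) ^+ 2 by apply: sqr_le2; lra.
  by have := sqr_ge0 (q%:~R - y); move: hd; rewrite /dist2; lra.
have q0 : 0 <= q.
  rewrite leNgt; apply/negP => q0.
  have h : q%:~R <= (-1 : int)%:~R :> R by rewrite ler_int; clear -q0; lia.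
  have h1 : 1 ^+ 2 <= (y - q%:~R) ^+ 2 by apply: sqr_le2; lra.
  by have := sqr_ge0 (p%:~R - x); move: hd; rewrite /dist2; lra.
have pR : 0 <= p%:~R :> R by rewrite ler0z.
have qR : 0 <= q%:~R :> R by rewrite ler0z.
have pq0 : 2 <= p + q.
  have [e|e] := eqVneq (p + q) 0; last by clear -p0 q0 e hk; lia.
  have [e1 e2] : p = 0 /\ q = 0 by clear -p0 q0 e; lia.
  by exfalso; move: hd; rewrite e1 e2 /dist2 mulr0z !sub0r !sqrrN; lra.
(* The squared distance is at least p^2 + q^2 >= (p + q)^2 / 2 >= 2. *)
have hN : 1 < dist2 p q s t.
  have h : (2 : int)%:~R <= p%:~R + q%:~R :> R by rewrite -rmorphD ler_int.
  have h1 : p%:~R ^+ 2 <= (p%:~R - s) ^+ 2 by apply: sqr_le2; lra.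
  have h2 : q%:~R ^+ 2 <= (q%:~R - t) ^+ 2 by apply: sqr_le2; lra.
  have h3 : 2 ^+ 2 <= (p%:~R + q%:~R : R) ^+ 2 by apply: sqr_le2; lra.
  by have := sqr_ge0 (p%:~R - q%:~R : R); rewrite /dist2; lra.
(* Lowering p adds at most 1 to the squared distance to (x, y), and less than 1 < [dist2 p q s t] to
   the one to (s, t). *)
have [px|px] := leP x p%:~R.
  exists (p - 1), q; split; first by exists (k - 1); clear -hk; lia.
    by move: hd; rewrite /dist2 rmorphB /=; nra.
  by left; move: hN; rewrite /dist2 rmorphB /=; nra.
have [qy|qy] := leP y q%:~R.
  exists p, (q - 1); split; first by exists (k - 1); clear -hk; lia.
    by move: hd; rewrite /dist2 rmorphB /=; nra.
  by left; move: hN; rewrite /dist2 rmorphB /=; nra.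
have [p1|p1] := leP 1 p.
  by apply: odd_improvement_step.
apply/odd_improvement_swap; apply: odd_improvement_step => //.
- exact: odd_separated_swap.
- by rewrite /dist2 addrC.
- by rewrite /dist2 addrC.
- by exists k; rewrite addrC.
- by clear -p0 p1 pq0; lia.
- by rewrite /dist2 addrC.
Qed.

Lemma odd_improvement_exists x y s t p q :
  1 < x ^+ 2 + y ^+ 2 -> s ^+ 2 + t ^+ 2 < 1 ->
  odd_separated x y s t -> (exists k : int, p + q = 2 * k) ->
  dist2 p q x y < 1 -> odd_improvement x y s t p q.
Proof.
have flip m n x0 y0 : dist2 (- m) n (- x0) y0 = dist2 m n x0 y0.
  by rewrite /dist2 rmorphN /=; ring.
have half x1 y1 s1 t1 p1 q1 : 0 <= y1 ->
    1 < x1 ^+ 2 + y1 ^+ 2 -> s1 ^+ 2 + t1 ^+ 2 < 1 ->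
    odd_separated x1 y1 s1 t1 -> (exists k : int, p1 + q1 = 2 * k) ->
    dist2 p1 q1 x1 y1 < 1 -> odd_improvement x1 y1 s1 t1 p1 q1.
  move=> y0 hxy hst hsep [k hk] hd; have [x0|x0] := leP 0 x1.
    by apply: odd_improvement_pos => //; exists k.
  apply: odd_improvement_flip1; apply: odd_improvement_pos; rewrite ?sqrrN ?flip //.
  - by lra.
  - exact: odd_separated_flip1.
  - by exists (q1 - k); lia.
move=> hxy hst hsep [k hk] hd; have [y0|y0] := leP 0 y.
  by apply: half => //; exists k.
(* The reflection in the other axis is the first one conjugated by the swap. *)
apply: odd_improvement_swap; apply: odd_improvement_flip1.
apply: odd_improvement_swap; apply: half; rewrite ?sqrrN //.
- by lra.
- exact/odd_separated_swap/odd_separated_flip1/odd_separated_swap.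
- by exists (p - k); lia.
- by move: hd; rewrite /dist2 rmorphN /=; nra.
Qed.

End OddPoint.

(** * The lexicographic preorder and finite enumeration *)

Section LexOrder.
Variable R : realType.
Implicit Types (x y z u v : 'rV[R[i]]_2) (L E : set 'rV[R[i]]_2).

Lemma row2_eq x y : x 0 0 = y 0 0 -> x 0 1 = y 0 1 -> x = y.
Proof.
move=> h0 h1; apply/rowP => j; have [->|->] : j = 0 \/ j = 1 => //.
by case: j => [[|[|//]]] ?; [left|right]; apply: val_inj.
Qed.

Lemma lex_precE x y : lex_prec x y <->
  sqn (x 0 1) < sqn (y 0 1) \/
  (sqn (x 0 1) = sqn (y 0 1) /\ sqn (x 0 0) <= sqn (y 0 0)).
Proof. by rewrite /lex_prec normc_lt normc_le normc_eq. Qed.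

Lemma lex_prec_trans x y z : lex_prec x y -> lex_prec y z -> lex_prec x z.
Proof.
rewrite !lex_precE => -[h1|[h1 h2]] [h3|[h3 h4]].
- by left; apply: lt_trans h3.
- by left; rewrite -h3.
- by left; rewrite h1.
- by right; split; [rewrite h1|apply: le_trans h4].
Qed.

Lemma lex_prec_total x y : lex_prec x y \/ lex_prec y x.
Proof.
rewrite !lex_precE.
have [h|h|->] := ltgtP (sqn (x 0 1)) (sqn (y 0 1)); [by left; left|by right; left|].
by have [h|/ltW h] := leP (sqn (x 0 0)) (sqn (y 0 0)); [left|right]; right.
Qed.

Lemma lex_prec_sqn x y : sqn (x 0 0) = sqn (y 0 0) ->
  sqn (x 0 1) = sqn (y 0 1) -> lex_prec x y.
Proof. by move=> h1 h2; apply/lex_precE; right; split=> //; rewrite h1. Qed.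

Lemma seq_lex_min (s : seq 'rV[R[i]]_2) E x : x \in s -> E x ->
  exists2 z, E z & forall y, y \in s -> E y -> lex_prec z y.
Proof.
elim: s x => // a s IH x; rewrite inE => /orP[/eqP ->|xs] Ex.
  have [[y [ys Ey]]|hn] := EM (exists y, y \in s /\ E y); last first.
    exists a => // y; rewrite inE => /orP[/eqP -> _|ys Ey].
      by case: (lex_prec_total a a).
    by exfalso; apply: hn; exists y.
  have [z Ez hz] := IH _ ys Ey.
  have [az|za] := lex_prec_total a z; [exists a|exists z] => // b;
    rewrite inE => /orP[/eqP ->|bs] Eb.
  - by case: (lex_prec_total a a).
  - exact: lex_prec_trans az (hz _ bs Eb).
  - exact: za.
  - exact: hz.
have [z Ez hz] := IH _ xs Ex; have [Ea|nEa] := EM (E a); last first.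
  by exists z => // b; rewrite inE => /orP[/eqP ->|bs] Eb //; apply: hz.
have [az|za] := lex_prec_total a z; [exists a|exists z] => // b;
  rewrite inE => /orP[/eqP ->|bs] Eb.
- by case: (lex_prec_total a a).
- exact: lex_prec_trans az (hz _ bs Eb).
- exact: za.
- exact: hz.
Qed.

Lemma gauss_enum (B : R) :
  exists s : seq R[i], forall g, gauss_int g -> sqn g <= B -> g \in s.
Proof.
pose K := Num.bound B.
pose I := [seq k%:Z - K%:Z | k <- iota 0 (2 * K).+1].
exists [seq (m%:~R + n%:~R * 'i : R[i]) | m <- I, n <- I] => g hg hB.
have [m [n [hm hn]]] := (gauss_intE g).1 hg.
have inI (k : int) : (k%:~R : R) ^+ 2 <= B -> k \in I.
  move=> hk; have : (k%:~R : R) ^+ 2 < K%:R.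
    by apply: le_lt_trans hk (archi_boundP (le_trans (sqr_ge0 _) hk)).
  rewrite -rmorphXn /= (_ : K%:R = (K%:Z)%:~R :> R) // ltr_int => hkK.
  apply/mapP; exists (absz (k + K%:Z)); last by clear -hkK; nia.
  by rewrite mem_iota; clear -hkK; nia.
apply/allpairsP; exists (m, n); split=> /=.
- by apply: inI; rewrite -hm; apply: le_trans hB; rewrite /sqn lerDl sqr_ge0.
- by apply: inI; rewrite -hn; apply: le_trans hB; rewrite /sqn lerDr sqr_ge0.
- have intC (k : int) : (k%:~R : R[i]) = (k%:~R : R)%:C%C by rewrite rmorph_int.
  by apply: complex_eqP; rewrite !ReImE !intC /= ?hm ?hn; ring.
Qed.

End LexOrder.

(** * Determinants and finiteness in a unimodular lattice *)

Section Lattice.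
Variables (R : realType) (L : set 'rV[R[i]]_2).
Hypothesis hL : unimodular_gauss_lattice L.
Implicit Types (x y z t u v s : 'rV[R[i]]_2) (a b c g : R[i]).

Lemma latticeD x y : L x -> L y -> L (x + y).
Proof. by case: hL => [[[_ h _] _ _] _]; apply: h. Qed.
Lemma latticeZ g x : gauss_int g -> L x -> L (g *: x).
Proof. by case: hL => [[[_ _ h] _ _] _]; apply: h. Qed.
Lemma latticeN x : L x -> L (- x).
Proof. by rewrite -scaleN1r; apply/latticeZ/gauss_intN/gauss_int1. Qed.

Lemma gauss_unit_basis : exists e1 e2, gauss_basis L e1 e2 /\
  gauss_int (detC e1 e2) /\ sqn (detC e1 e2) = 1.
Proof.
have [_ [e1 [e2 [hb hd]]]] := hL; exists e1, e2; split=> //.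
have hi := gauss_int_i R; have h1 := gauss_int1 R.
have sqni : sqn ('i : R[i]) = 1 by rewrite /sqn Re_i Im_i; ring.
by case: hd => ->; rewrite ?sqnN ?sqn1 ?sqni; do ?split => //; apply: gauss_intN.
Qed.

Lemma gauss_int_det x y : L x -> L y -> gauss_int (detC x y).
Proof.
have [e1 [e2 [[_ _ hb _] [hd _]]]] := gauss_unit_basis.
move=> /hb[a [b [ha hb1 ->]]] /hb[c [d [hc hd1 ->]]].
have -> : detC (a *: e1 + b *: e2) (c *: e1 + d *: e2) =
    (a * d - b * c) * detC e1 e2 by rewrite /detC !mxE; ring.
by apply: gauss_intM => //; apply: gauss_intB; apply: gauss_intM.
Qed.

Lemma sqn_det_le x y : sqn (detC x y) <=
  (sqn (x 0 0) + sqn (x 0 1)) * (sqn (y 0 0) + sqn (y 0 1)).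
Proof.
rewrite /detC -mulrN; apply: le_trans (cauchy_schwarz _ _ _ _) _.
by rewrite sqnN [sqn (y 0 1) + _]addrC.
Qed.

(** By Cramer's rule the coordinates in a basis are determinants up to a unit, so [sqn_det_le]
    bounds them. *)
Lemma lattice_enum (B : R) : exists s : seq 'rV[R[i]]_2,
  forall z, L z -> sqn (z 0 0) <= B -> sqn (z 0 1) <= B -> z \in s.
Proof.
have [e1 [e2 [[_ _ hb _] [_ hd]]]] := gauss_unit_basis.
pose B1 := 2 * B * (sqn (e1 0 0) + sqn (e1 0 1) + sqn (e2 0 0) + sqn (e2 0 1)).
have [G hG] := gauss_enum B1.
exists [seq a *: e1 + b *: e2 | a <- G, b <- G] => z Lz h0 h1.
have [a [b [ha hb1 zE]]] := hb _ Lz.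
have hz0 := sqn_ge0 (z 0 0); have hz1 := sqn_ge0 (z 0 1).
have p1 := sqn_ge0 (e1 0 0); have p2 := sqn_ge0 (e1 0 1).
have p3 := sqn_ge0 (e2 0 0); have p4 := sqn_ge0 (e2 0 1).
apply/allpairsP; exists (a, b); split => //=; apply: hG => //.
- have -> : sqn a = sqn (detC z e2).
    by rewrite zE -[LHS]mulr1 -hd -sqnM /detC !mxE; congr sqn; ring.
  by apply: le_trans (sqn_det_le _ _) _; rewrite /B1; nra.
- have -> : sqn b = sqn (detC e1 z).
    by rewrite zE -[LHS]mulr1 -hd -sqnM /detC !mxE; congr sqn; ring.
  by apply: le_trans (sqn_det_le _ _) _; rewrite /B1; nra.
Qed.

(** * The lexicographic minimum as the following minimal vector *)

Definition below v z := [/\ L z, z <> 0 & sqn (z 0 0) < sqn (v 0 0)].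
Definition next v z := below v z /\ forall y, below v y -> lex_prec z y.

(** The search is confined to a finite box: a vector below [v] and outside it comes after the given
    one. *)
Lemma next_exists v : (exists z, below v z) -> exists z, next v z.
Proof.
move=> [z0 hz0]; pose B := sqn (z0 0 1) + sqn (v 0 0).
have q1 := sqn_ge0 (z0 0 1); have q2 := sqn_ge0 (v 0 0).
have [s hs] := lattice_enum B.
have hin z : below v z -> sqn (z 0 1) <= B -> z \in s.
  by move=> [Lz _ hz] hB; apply: hs => //; rewrite /B; lra.
have [|z hz zmin] := seq_lex_min (E := below v) (hin _ hz0 _) hz0.
  by rewrite /B; lra.
exists z; split=> // y hy; have [yB|yB] := leP (sqn (y 0 1)) B.
  by apply: zmin => //; apply: hin.
apply: lex_prec_trans (zmin _ (hin _ hz0 _) hz0) _; first by rewrite /B; lra.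
by apply/lex_precE; left; move: yB; rewrite /B; lra.
Qed.

Lemma minimal_vectorE v : minimal_vector L v <-> [/\ L v, v <> 0 &
  forall z, L z -> z <> 0 -> sqn (z 0 0) <= sqn (v 0 0) ->
    sqn (z 0 1) <= sqn (v 0 1) ->
    sqn (z 0 0) = sqn (v 0 0) /\ sqn (z 0 1) = sqn (v 0 1)].
Proof.
split=> -[h1 h2 h3]; split=> // z Lz z0.
  rewrite -!normc_le -!normc_eq => a b; exact: h3.
by move=> [a b]; rewrite !normc_eq; apply: h3; rewrite // -normc_le.
Qed.

(** The vectors in the cylinder of [z] are also below [v], so they cannot beat [z]. A minimal vector
    strictly between would either be below [v] and precede [z], or have [v] in its cylinder. *)
Lemma next_consecutive v z : minimal_vector L v -> next v z ->
  [/\ minimal_vector L z, consecutive L v z & sqn (v 0 1) < sqn (z 0 1)].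
Proof.
move=> hv [[Lz z0 zv] hz]; have [Lv v0 vmin] := (minimal_vectorE v).1 hv.
have hz' : minimal_vector L z.
  apply/minimal_vectorE; split=> // y Ly y0 y1 y2.
  have /lex_precE := hz y (And3 Ly y0 (le_lt_trans y1 zv)).
  by move=> [h|[h1 h2]]; lra.
have vz : sqn (v 0 1) < sqn (z 0 1).
  by rewrite ltNge; apply/negP => h; have := vmin _ Lz z0 (ltW zv) h; lra.
split=> //; split=> //; first by rewrite normc_lt.
move=> [w [hw]]; rewrite !normc_lt => vw wz.
have [Lw w0 wmin] := (minimal_vectorE w).1 hw.
have [h|h] := ltP (sqn (w 0 0)) (sqn (v 0 0)).
  by have /lex_precE := hz w (And3 Lw w0 h); lra.
by have := wmin _ Lv v0 h (ltW vw); lra.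
Qed.

(** * Inequalities for a consecutive pair *)

Section Consecutive.
Variables u v : 'rV[R[i]]_2.
Hypothesis huv : consecutive L u v.

Lemma consecutive_lt1 : sqn (u 0 1) < sqn (v 0 1).
Proof. by rewrite -normc_lt; case: huv. Qed.

Lemma consecutive_lt0 : sqn (v 0 0) < sqn (u 0 0).
Proof.
have h := consecutive_lt1; rewrite ltNge; apply/negP => h'.
have [/minimal_vectorE[Lu u0 _] /minimal_vectorE[_ _ vmin] _ _] := huv.
by have := vmin _ Lu u0 h' (ltW h); lra.
Qed.

(* The lexicographic minimum of the vectors below [u] is a minimal vector after
   [u], hence at least as high as [v]. *)
Lemma consecutive_box z : below u z -> sqn (v 0 1) <= sqn (z 0 1).
Proof.
move=> hz; have [hu /minimal_vectorE[Lv v0 _] _ hw] := huv.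
have [s hs] := next_exists (ex_intro _ z hz).
have [hms _ us] := next_consecutive hu hs.
have vs : sqn (v 0 1) <= sqn (s 0 1).
  rewrite leNgt; apply/negP => sv; apply: hw; exists s.
  by rewrite !normc_lt.
by have /lex_precE := hs.2 _ hz; lra.
Qed.

(** Rounding the quotient of the first coordinates to [g] makes - u + g v short enough; it is
    nonzero because u = g v with smaller second coordinate would force g = 0. *)
Lemma below_nonempty : v 0 0 != 0 -> exists z, below v z.
Proof.
move=> v00; have [g hg hr] := gauss_round (u 0 0 / v 0 0).
have [/minimal_vectorE[Lu u0 _] /minimal_vectorE[Lv v0 _] _ _] := huv.
exists (- u + g *: v); split.
- by apply: latticeD; [apply: latticeN|apply: latticeZ].
- move=> h; have uE : u = g *: v by rewrite -[u]opprK -[LHS]addr0 -h addKr.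
  apply: u0; have := consecutive_lt1; rewrite uE mxE sqnM => h1.
  rewrite (gauss_small hg) ?scale0r //.
  have := sqn_ge0 (v 0 1); nra.
- have -> : (- u + g *: v) 0 0 = - (u 0 0 / v 0 0 - g) * v 0 0.
    by rewrite !mxE; field.
  have : 0 < sqn (v 0 0) by rewrite sqn_gt0.
  by rewrite sqnM sqnN; nra.
Qed.

End Consecutive.

(** * The determinant of a minimal vector and its successor *)

Lemma det_expansion v t z : detC v t = 1 -> z = detC z t *: v + detC v z *: t.
Proof.
by move=> h; apply: row2_eq; rewrite !mxE -[LHS]mulr1 -h /detC; ring.
Qed.

(* If z = k t + j v and s = c v + d t then d z = k s + (j d - k c) v. *)
Lemma next_det v t s : minimal_vector L v -> L t -> detC v t = 1 ->
  next v s -> sqn (detC v s) <= 2.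
Proof.
move=> hv Lt h1 hs; have [hms _ vs] := next_consecutive hv hs.
have [Lv v0 vmin] := (minimal_vectorE v).1 hv.
have [[Ls s0 sv] smin] := hs.
have hd := gauss_int_det Lv Ls; have hc := gauss_int_det Ls Lt.
have sE := det_expansion s h1.
set d := detC v s in hd sE *; set c := detC s t in hc sE.
rewrite leNgt; apply/negP => d2.
(* No sum of two integer squares equals 3. *)
have d4 : 4 <= sqn d.
  rewrite leNgt; apply/negP => d4.
  have [m [n [hm hn]]] := (gauss_intE d).1 hd.
  have : sqn d = (m ^+ 2 + n ^+ 2)%:~R by rewrite /sqn hm hn rmorphD !rmorphXn.
  move=> dE; have := d2; have := d4; rewrite dE.
  rewrite (ltr_int R _ 4) (ltr_int R 2) => a1 a2.
  have h3 : `|m| <= 1 by clear -a1; nia.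
  have h4 : `|n| <= 1 by clear -a1; nia.
  by clear -a1 a2 h3 h4; nia.
have [k [j [hk hj pos hle]]] := gauss_reduction hc hd d4.
set y := j * d - k * c in pos hle.
pose z := k *: t + j *: v.
have zE i : d * z 0 i = k * s 0 i + y * v 0 i.
  by rewrite sE /y !mxE; ring.
(* By Cauchy-Schwarz and the reduction, |z_i|^2 is at most the mean of |s_i|^2 and |v_i|^2. The mean
   is below |v_1|^2 in the first coordinate and below |s_2|^2 in the second, so z is below [v] and
   precedes s. *)
have bound i (B : R) : sqn (s 0 i) + sqn (v 0 i) < 2 * B -> sqn (z 0 i) < B.
  move=> hB; have := cauchy_schwarz k y (s 0 i) (v 0 i); rewrite -zE sqnM.
  have := sqn_ge0 (s 0 i); have := sqn_ge0 (v 0 i); have := sqn_ge0 (z 0 i).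
  set Z := sqn (z 0 i); set S := sqn (s 0 i) + _; set N := sqn k + _ => Z0 q1 q2 hZ.
  rewrite ltNge; apply/negP => BZ.
  have : N * S < N * (2 * B) by rewrite ltr_pM2l.
  have : 2 * N * B <= sqn d * B by rewrite ler_wpM2r //; lra.
  have : sqn d * B <= sqn d * Z by rewrite ler_wpM2l //; lra.
  by lra.
have z1 : sqn (z 0 0) < sqn (v 0 0) by apply: bound; lra.
have z2 : sqn (z 0 1) < sqn (s 0 1) by apply: bound; lra.
have z0 : z <> 0.
  move=> z0; have k0 : k = 0.
    by have : detC v z = k * detC v t; [rewrite /detC !mxE; ring|
      rewrite h1 mulr1 z0 /detC !mxE => <-; ring].
  have j0 : j = 0.
    by have : detC z t = j * detC v t; [rewrite /detC !mxE; ring|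
      rewrite h1 mulr1 z0 /detC !mxE => <-; ring].
  by move: pos; rewrite /y k0 j0 !mul0r subr0 sqn0 addr0 ltxx.
have Lz : L z by apply: latticeD; apply: latticeZ.
by have /lex_precE := smin z (And3 Lz z0 z1); lra.
Qed.

(** Otherwise [s] would be a Gaussian multiple of [v] with smaller first coordinate, hence zero. *)
Lemma next_det_neq0 v t s : minimal_vector L v -> L t -> detC v t = 1 ->
  next v s -> detC v s != 0.
Proof.
move=> /minimal_vectorE[Lv _ _] Lt h1 [[Ls s0 sv] _]; apply/eqP => d0.
have sE := det_expansion s h1; rewrite d0 scale0r addr0 in sE.
apply: s0; rewrite sE (gauss_small (gauss_int_det Ls Lt)) ?scale0r //.
by move: sv; rewrite {1}sE mxE sqnM; have := sqn_ge0 (v 0 0); nra.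
Qed.

(** Multiplication by a unit preserves both moduli; this allows the determinant with [v] to be
    normalised. *)
Lemma next_unit_mul v s a : gauss_int a -> sqn a = 1 -> next v s ->
  next v (a *: s).
Proof.
move=> ha a1 [[Ls s0 sv] smin].
have sq i : sqn ((a *: s) 0 i) = sqn (s 0 i) by rewrite mxE sqnM a1 mul1r.
split; first split.
- exact: latticeZ.
- move=> /eqP; rewrite scaler_eq0 -sqn_eq0 a1 oner_eq0 => /eqP; exact: s0.
- by rewrite sq.
by move=> y hy; apply: lex_prec_trans (smin _ hy); apply: lex_prec_sqn.
Qed.

(** A set of vectors below [v] that reaches a lower bound of all of them has its lexicographic
    minima among theirs. *)
Lemma next_lex_minimal v (E : set 'rV[R[i]]_2) z0 :
  (forall z, E z -> below v z) -> E z0 ->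
  (forall y, below v y -> lex_prec z0 y) ->
  [/\ next v z0, lex_minimal E z0 & forall z, lex_minimal E z -> next v z].
Proof.
move=> hE Ez0 hz0; split; first by split => //; apply: hE.
  by split=> // z Ez _; apply/hz0/hE.
move=> z [Ez zmin]; split; first exact: hE.
move=> y hy; apply: lex_prec_trans (hz0 _ hy).
by have [//|h] := lex_prec_total z z0; apply: zmin.
Qed.

End Lattice.

(** * Arithmetic modulo 1 + i *)

Section OneI.
Variable R : realType.
Implicit Types (a b g : R[i]).

Lemma sqn_1i : sqn (1 + 'i : R[i]) = 2.
Proof. by rewrite /sqn !ReImE; ring. Qed.

Lemma addr1i_neq0 : (1 + 'i : R[i]) != 0.
Proof. by rewrite -sqn_gt0 sqn_1i; lra. Qed.

Lemma gauss_int_1i : gauss_int (1 + 'i : R[i]).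
Proof. exact: gauss_intD (gauss_int1 R) (gauss_int_i R). Qed.

Lemma int_parity (m : int) : (exists k, m = 2 * k) \/ (exists k, m = 2 * k + 1).
Proof.
have [h|h] : m = 2 * (m %/ 2)%Z \/ m = 2 * (m %/ 2)%Z + 1 by lia.
  by left; exists (m %/ 2)%Z.
by right; exists (m %/ 2)%Z.
Qed.

Lemma even_1i (m n k : int) : m + n = 2 * k ->
  (m%:~R +i* n%:~R)%C = (1 + 'i) * (k%:~R +i* (n - k)%:~R)%C :> R[i].
Proof.
move=> hk; have -> : m = 2 * k - n by rewrite -hk; ring.
by apply: complex_eqP; rewrite !ReImE /= ?intrB ?intrM; ring.
Qed.

Lemma gauss_int_pair (m n : int) : gauss_int (m%:~R +i* n%:~R : R[i])%C.
Proof. by apply/gauss_intE; exists m, n. Qed.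

Lemma odd_point_1i (m n : int) : odd_point m n ->
  exists2 g : R[i], gauss_int g & (1 + 'i) * g = 1 + (m%:~R +i* n%:~R)%C.
Proof.
move=> [k hk]; exists ((k + 1)%:~R +i* (n - (k + 1))%:~R)%C; first exact: gauss_int_pair.
rewrite -(@even_1i (m + 1)); last by lia.
by apply: complex_eqP; rewrite !ReImE /= ?intrD; ring.
Qed.

(** The residue field of 1 + i has two elements, told apart by the parity of the sum of the two
    parts. *)
Lemma gauss_mod_1i a : gauss_int a ->
  exists2 g, gauss_int g & a = (1 + 'i) * g \/ a = 1 + (1 + 'i) * g.
Proof.
move=> /gauss_intE[m [n [hm hn]]].
have aE : a = (m%:~R +i* n%:~R)%C by apply: complex_eqP.
have [[k h]|[k h]] := int_parity (m + n);
  exists (k%:~R +i* (n - k)%:~R)%C; try exact: gauss_int_pair.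
  by left; rewrite -(even_1i h).
have {}h : (m - 1) + n = 2 * k by rewrite addrAC h addrK.
right; rewrite -(even_1i h) aE.
by apply: complex_eqP; rewrite !ReImE /= ?intrB; ring.
Qed.

Lemma gauss_unit_assoc a : gauss_int a -> a != 0 -> sqn a <= 2 ->
  exists c, [/\ gauss_int c, sqn c = 1 &
    (c * a = 1 /\ sqn a = 1) \/ (c * a = 1 + 'i /\ sqn a = 2)].
Proof.
move=> /gauss_intE[m [n [hm hn]]].
have aE : a = (m%:~R +i* n%:~R)%C by apply: complex_eqP.
have sa : sqn a = (m ^+ 2 + n ^+ 2)%:~R by rewrite /sqn hm hn rmorphD !rmorphXn.
rewrite -sqn_gt0 sa (ler_int R _ 2) (ltr_int R 0) => a0 a2.
(* With the unit written p + q i, the claim becomes a check over integers, finite since m and n lie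
   between -1 and 1. *)
suff [p [q [h1 h2]]] : exists p q : int, p ^+ 2 + q ^+ 2 = 1 /\
    ((p * m - q * n = 1 /\ p * n + q * m = 0 /\ m ^+ 2 + n ^+ 2 = 1) \/
     (p * m - q * n = 1 /\ p * n + q * m = 1 /\ m ^+ 2 + n ^+ 2 = 2)).
  exists (p%:~R +i* q%:~R)%C; split; first exact: gauss_int_pair.
    by rewrite /sqn /= -!rmorphXn -rmorphD /= h1.
  by case: h2 => -[e1 [e2 e3]]; [left|right]; rewrite e3; split=> //;
    rewrite aE; apply: complex_eqP; rewrite !ReImE /= -!rmorphM -?rmorphB -?rmorphD /= ?e1 ?e2 //; ring.
have hm' : m = -1 \/ m = 0 \/ m = 1 by clear -a2; nia.
have hn' : n = -1 \/ n = 0 \/ n = 1 by clear -a2; nia.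
move: a0; clear -hm' hn'.
case: hm' => [->|[->|->]]; case: hn' => [->|[->|->]] => //= _.
- by exists (-1), 0; split=> //; right.
- by exists (-1), 0; split=> //; left.
- by exists 0, (-1); split=> //; right.
- by exists 0, 1; split=> //; left.
- by exists 0, (-1); split=> //; left.
- by exists 0, 1; split=> //; right.
- by exists 1, 0; split=> //; left.
- by exists 1, 0; split=> //; right.
Qed.

End OneI.

(** * Locating the successor of v in E_1 or E_2 *)

Section ConsecutivePair.
Variables (R : realType) (L : set 'rV[R[i]]_2).
Hypothesis hL : unimodular_gauss_lattice L.
Variables u v : 'rV[R[i]]_2.
Hypothesis huv : consecutive L u v.
Hypothesis v0_neq0 : v 0 0 != 0.
Implicit Types (x y z t s : 'rV[R[i]]_2) (a b c g : R[i]).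

Let hu : minimal_vector L u. Proof. by case: huv. Qed.
Let hv : minimal_vector L v. Proof. by case: huv. Qed.
Let Lu : L u. Proof. by case: hu. Qed.
Let Lv : L v. Proof. by case: hv. Qed.
Let lt0 : sqn (v 0 0) < sqn (u 0 0). Proof. exact: consecutive_lt0 huv. Qed.
Let lt1 : sqn (u 0 1) < sqn (v 0 1). Proof. exact: consecutive_lt1 huv. Qed.
Let u0_neq0 : u 0 0 != 0.
Proof. by rewrite -sqn_gt0; have := sqn_ge0 (v 0 0); have := lt0; lra. Qed.
Let v1_neq0 : v 0 1 != 0.
Proof. by rewrite -sqn_gt0; have := sqn_ge0 (u 0 1); have := lt1; lra. Qed.

(** Multiplying by the first coordinate of [v] turns the inequality that defines E_1 into the one
    that defines [below]. *)
Lemma E1_param_lt a g :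
  (`|a / (v 0 0 / u 0 0) - g| < 1) = (sqn (E1_vec u v a g 0 0) < sqn (v 0 0)).
Proof.
rewrite normc_lt1 -(sqn_mul_lt _ v0_neq0) -sqnN /E1_vec !mxE; congr (sqn _ < _).
by field; rewrite u0_neq0 v0_neq0.
Qed.

Lemma E2_param_lt g :
  (`|1 / ((1 + 'i) * (v 0 0 / u 0 0)) + 1 / (1 + 'i) - g| < 1)
  = (sqn (E2_vec u v g 0 0) < sqn (v 0 0)).
Proof.
rewrite normc_lt1 -(sqn_mul_lt _ v0_neq0) -sqnN /E2_vec !mxE; congr (sqn _ < _).
by field; rewrite u0_neq0 v0_neq0 addr1i_neq0.
Qed.

(** Such a vector is nonzero because its determinant with [v] is a. *)
Lemma E1_below z : detC u v = 1 -> E1 u v (v 0 0 / u 0 0) z -> below L v z.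
Proof.
move=> h1 [a [g [[ha hg hlt] zE]]]; rewrite E1_param_lt -zE in hlt.
have Ga : gauss_int a by case: ha => ->; [exact: gauss_int1|exact: gauss_int_1i].
have a0 : a <> 0 by case: ha => -> /eqP; apply/negP; [exact: oner_neq0|exact: addr1i_neq0].
split=> //.
  by rewrite zE /E1_vec; apply: (latticeD hL); apply: (latticeZ hL) => //; apply: gauss_intN.
move=> z0; apply: a0; rewrite -[LHS]mulr1 -h1.
have -> : a * detC u v = detC v z by rewrite zE /E1_vec /detC !mxE; ring.
by rewrite z0 /detC !mxE; ring.
Qed.

(** The two values of a are the normal forms, up to a unit, of the possible determinants of [v] with
    its successor. *)
Lemma E1_lex_prec : detC u v = 1 -> exists2 z0, E1 u v (v 0 0 / u 0 0) z0 &
  forall y, below L v y -> lex_prec z0 y.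
Proof.
move=> h1.
have [s hs] := next_exists hL (below_nonempty hL huv v0_neq0).
have LNu : L (- u) by exact: (latticeN hL).
have ht : detC v (- u) = 1 by rewrite -h1 /detC !mxE; ring.
have [[Ls _ _] _] := hs.
have [c [hc c1 ca]] := gauss_unit_assoc (gauss_int_det hL Lv Ls)
  (next_det_neq0 hL hv LNu ht hs) (next_det hL hv LNu ht hs).
have [[Lz z0 zlt] zmin] := next_unit_mul hL hc c1 hs.
exists (c *: s) => //; exists (c * detC v s), (c * detC s (- u)).
have zE : c *: s = E1_vec u v (c * detC v s) (c * detC s (- u)).
  rewrite {1}(det_expansion s ht) /E1_vec.
  by apply: row2_eq; rewrite !mxE; ring.
split=> //; split; [by case: ca => -[-> _]; [left|right]| |].
  by apply: gauss_intM hc _; apply: (gauss_int_det hL).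
by rewrite E1_param_lt -zE.
Qed.

(** The quotient would lie in the cylinder of [x] with strictly smaller moduli. *)
Lemma half_not_lattice x : minimal_vector L x -> ~ L ((1 / (1 + 'i)) *: x).
Proof.
move=> /minimal_vectorE[Lx x0 xmin] Ly; set y := _ *: x in Ly.
have xE : x = (1 + 'i) *: y.
  by rewrite /y scalerA mulrC divfK ?addr1i_neq0 // scale1r.
have xs i : sqn (x 0 i) = 2 * sqn (y 0 i) by rewrite xE mxE sqnM sqn_1i.
have p0 := sqn_ge0 (y 0 0); have p1 := sqn_ge0 (y 0 1).
have y0 : y <> 0 by move=> y0; apply: x0; rewrite xE y0 scaler0.
have [] := xmin y Ly y0; rewrite ?xs; [lra|lra|] => h0 h1.
apply: x0; apply: row2_eq; rewrite mxE; apply/eqP; rewrite -sqn_eq0 xs; apply/eqP; lra.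
Qed.

(** By Cramer's rule the coordinates in u, v have denominator 1 + i. Reducing the numerators leaves
    0, u, v or u + v over 1 + i, and minimality excludes the middle two. *)
Lemma span_or_half_sum x : detC u v = 1 + 'i -> L x ->
  (exists a b, [/\ gauss_int a, gauss_int b & x = a *: u + b *: v]) \/
  L ((1 / (1 + 'i)) *: (u + v)).
Proof.
move=> h1 Lx.
have n0 := addr1i_neq0 R.
have xE : x = (detC x v / (1 + 'i)) *: u + (detC u x / (1 + 'i)) *: v.
  apply: row2_eq; rewrite !mxE; apply: (mulfI n0).
    by rewrite -{1}h1 /detC; field.
  by rewrite -{1}h1 /detC; field.
have [a ha aE] := gauss_mod_1i (gauss_int_det hL Lx Lv).
have [b hb bE] := gauss_mod_1i (gauss_int_det hL Lu Lx).
have Ly : L (x - a *: u - b *: v).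
  by do 2?[apply: (latticeD hL) => //]; apply/(latticeN hL)/(latticeZ hL).
case: aE bE => [aE|aE] [bE|bE].
- left; exists a, b; split=> //; rewrite {1}xE aE bE.
  by rewrite ![(1 + 'i) * _]mulrC !mulfK.
- exfalso; apply: (half_not_lattice hv).
  suff <- : x - a *: u - b *: v = (1 / (1 + 'i)) *: v by [].
  by rewrite {1}xE aE bE; apply: row2_eq; rewrite !mxE; field.
- exfalso; apply: (half_not_lattice hu).
  suff <- : x - a *: u - b *: v = (1 / (1 + 'i)) *: u by [].
  by rewrite {1}xE aE bE; apply: row2_eq; rewrite !mxE; field.
- right.
  suff <- : x - a *: u - b *: v = (1 / (1 + 'i)) *: (u + v) by [].
  by rewrite {1}xE aE bE; apply: row2_eq; rewrite !mxE; field.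
Qed.

(** Otherwise u and v would generate the lattice and 1 + i would divide the determinant of a basis,
    a unit. *)
Lemma half_sum_lattice : detC u v = 1 + 'i -> L ((1 / (1 + 'i)) *: (u + v)).
Proof.
move=> h1; have [e1 [e2 [[L1 L2 _ _] [_ hd]]]] := gauss_unit_basis hL.
have [[a [b [ha hb e1E]]]|//] := span_or_half_sum h1 L1.
have [[c [d [hc hd' e2E]]]|//] := span_or_half_sum h1 L2.
exfalso; have : detC e1 e2 = (a * d - b * c) * (1 + 'i).
  by rewrite -h1 e1E e2E /detC !mxE; ring.
have [|n hn] := @sqn_gauss R (a * d - b * c); first by apply: gauss_intB; apply: gauss_intM.
move=> hE; move: hd; rewrite hE sqnM sqn_1i hn -natrM => /eqP.
by rewrite (eqr_nat R _ 1); lia.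
Qed.

Lemma E2_below z : detC u v = 1 + 'i -> E2 u v (v 0 0 / u 0 0) z -> below L v z.
Proof.
move=> h1 [g [[hg hlt] zE]]; rewrite E2_param_lt -zE in hlt.
split=> //.
  rewrite zE /E2_vec scaleNr; apply: (latticeD hL); last exact: (latticeZ hL).
  by apply: (latticeN hL); apply: half_sum_lattice.
move=> z0; have : detC v z = 1.
  rewrite zE -[RHS](divff (addr1i_neq0 R)) -[X in X / _]h1 /E2_vec /detC !mxE.
  by field; rewrite addr1i_neq0.
by rewrite z0 /detC !mxE !mulr0 subr0 => /eqP; rewrite eq_sym oner_eq0.
Qed.

Lemma E2_lex_prec : detC u v = 1 + 'i ->
  exists2 z0, E2 u v (v 0 0 / u 0 0) z0 & forall y, below L v y -> lex_prec z0 y.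
Proof.
move=> h1; have n0 := addr1i_neq0 R.
have [s hs] := next_exists hL (below_nonempty hL huv v0_neq0).
pose t := - (1 / (1 + 'i)) *: (u + v).
have Lt : L t by rewrite /t scaleNr; apply/(latticeN hL)/half_sum_lattice.
have ht : detC v t = 1.
  rewrite -[RHS](divff n0) -[X in X / _]h1 /t /detC !mxE; field; exact: n0.
have E2I z g : gauss_int g -> z = t + g *: v -> sqn (z 0 0) < sqn (v 0 0) ->
    E2 u v (v 0 0 / u 0 0) z.
  by move=> hg zE hz; exists g; split=> //; split=> //; rewrite E2_param_lt -[E2_vec _ _ _]zE.
have [[Ls _ _] _] := hs.
have [c [hc c1 ca]] := gauss_unit_assoc (gauss_int_det hL Lv Ls)
  (next_det_neq0 hL hv Lt ht hs) (next_det hL hv Lt ht hs).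
have hs' := next_unit_mul hL hc c1 hs; set s' := c *: s in hs'.
have [[Ls' s'0 s'lt] s'min] := hs'.
have [_ _ vs'] := next_consecutive hv hs'.
have hg := gauss_int_det hL Ls' Lt; set g0 := detC s' t in hg.
have s'E : s' = g0 *: v + (c * detC v s) *: t.
  rewrite {1}(det_expansion s' ht); congr (_ + _ *: _).
  by rewrite /s' /detC !mxE; ring.
case: ca => -[ca _]; rewrite ca in s'E.
  by exists s' => //; apply: (E2I _ g0); rewrite // s'E scale1r addrC.
(* The remaining determinant is 1 + i, and (1 + i) t = - (u + v). *)
have {}s'E i : s' 0 i = - u 0 i + (g0 - 1) * v 0 i.
  by rewrite s'E /t !mxE; field.
have [p [q [hp hq]]] := (gauss_intE (g0 - 1)).1 (gauss_intB hg (gauss_int1 R)).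
pose al := u 0 0 / v 0 0; pose be := u 0 1 / v 0 1.
have dist_s0 : sqn (s' 0 0) = sqn (v 0 0) * dist2 p q (Re al) (Im al).
  have -> : s' 0 0 = v 0 0 * (g0 - 1 - al) by rewrite s'E /al; field.
  by rewrite sqnM /dist2 /sqn ReD ImD ReN ImN hp hq.
have dist_s1 : sqn (s' 0 1) = sqn (v 0 1) * dist2 p q (Re be) (Im be).
  have -> : s' 0 1 = v 0 1 * (g0 - 1 - be) by rewrite s'E /be; field.
  by rewrite sqnM /dist2 /sqn ReD ImD ReN ImN hp hq.
have pv0 : 0 < sqn (v 0 0) by rewrite sqn_gt0.
have pv1 : 0 < sqn (v 0 1) by rewrite sqn_gt0.
have half_point m n : odd_point m n -> exists g, [/\ gauss_int g,
    forall i, (1 + 'i) * (t + g *: v) 0 i = - u 0 i + (m%:~R +i* n%:~R)%C * v 0 i,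
    2 * sqn ((t + g *: v) 0 0) = sqn (v 0 0) * dist2 m n (Re al) (Im al) &
    2 * sqn ((t + g *: v) 0 1) = sqn (v 0 1) * dist2 m n (Re be) (Im be)].
  move=> ho; have [g Gg gE] := odd_point_1i R ho; exists g.
  have tE i : (1 + 'i) * (t + g *: v) 0 i = - u 0 i + (m%:~R +i* n%:~R)%C * v 0 i.
    have -> : (1 + 'i) * (t + g *: v) 0 i
        = - (u 0 i + v 0 i) + ((1 + 'i) * g) * v 0 i.
      by rewrite /t !mxE; field; exact: n0.
    by rewrite gE; ring.
  split=> //; rewrite -sqn_1i -sqnM tE.
    have -> : - u 0 0 + (m%:~R +i* n%:~R)%C * v 0 0 =
      v 0 0 * ((m%:~R +i* n%:~R)%C - al) by rewrite /al; field.
    by rewrite sqnM /dist2 /sqn ReD ImD ReN ImN.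
  have -> : - u 0 1 + (m%:~R +i* n%:~R)%C * v 0 1 =
    v 0 1 * ((m%:~R +i* n%:~R)%C - be) by rewrite /be; field.
  by rewrite sqnM /dist2 /sqn ReD ImD ReN ImN.
have LY g : gauss_int g -> L (t + g *: v).
  by move=> Gg; apply: (latticeD hL) => //; apply: (latticeZ hL).
have Y0 g : t + g *: v <> 0.
  move=> h; have : detC v (t + g *: v) = 1 by rewrite -ht /detC !mxE; ring.
  by rewrite h /detC !mxE !mulr0 subr0 => /eqP; rewrite eq_sym oner_eq0.
(* If p + q were odd, s' / (1 + i) would be a lattice vector below [v] preceding s'. *)
have heven : exists k : int, p + q = 2 * k.
  have [//|ho] := int_parity (p + q); exfalso.
  have [g [Gg _ e0 e1]] := half_point _ _ ho.
  have hY : below L v (t + g *: v).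
    split; [exact: LY|exact: Y0|]; have := sqn_ge0 ((t + g *: v) 0 0).
    by move: e0; rewrite -dist_s0; lra.
  have /lex_precE := s'min _ hY; have := sqn_ge0 (v 0 1).
  by move: e1; rewrite -dist_s1; lra.
have al_sqn : sqn al * sqn (v 0 0) = sqn (u 0 0) by rewrite -sqnM /al divfK.
have be_sqn : sqn be * sqn (v 0 1) = sqn (u 0 1) by rewrite -sqnM /be divfK.
have al1 : 1 < sqn al.
  by rewrite -(ltr_pM2r pv0) mul1r al_sqn.
have be1 : sqn be < 1.
  by rewrite -(ltr_pM2r pv1) mul1r be_sqn.
have hsep : odd_separated (Re al) (Im al) (Re be) (Im be).
  move=> m n ho; have [g [Gg _ e0 e1]] := half_point _ _ ho.
  split=> hd; [rewrite ltNge|rewrite leNgt]; apply/negP => hd'.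
    have [_ _ vmin] := (minimal_vectorE L v).1 hv.
    by have := vmin _ (LY _ Gg) (Y0 g); nra.
  have : below L u (t + g *: v).
    split; [exact: LY|exact: Y0|]; rewrite -al_sqn.
    by move: hd; rewrite -[_ + _]/(sqn al); nra.
  by move/(consecutive_box hL huv); nra.
have hd : dist2 p q (Re al) (Im al) < 1.
  by move: s'lt; rewrite dist_s0 -[X in _ < X]mulr1 ltr_pM2l.
have [m [n [ho d1 d2]]] := odd_improvement_exists al1 be1 hsep heven hd.
have [g [Gg _ e0 e1]] := half_point _ _ ho.
exists (t + g *: v); first by apply: (E2I _ g) => //; nra.
move=> y hy; apply: lex_prec_trans (s'min _ hy).
apply/lex_precE; rewrite dist_s0 dist_s1; case: d2 => [d2|[d2 d3]].
  by left; nra.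
by right; split; nra.
Qed.

End ConsecutivePair.

(** * The successor of v and its parameters, by cases on det(u, v) *)

Theorem theorem3 (R : realType) (L : set 'rV[R[i]]_2) (u v : 'rV[R[i]]_2)
    (w1 w2 : R[i])
    (hL : unimodular_gauss_lattice L)
    (huv : consecutive L u v)
    (hw1 : w1 = v 0 0 / u 0 0)
    (hw2 : w2 = u 0 1 / v 0 1)
    (hw1n0 : w1 <> 0) :
  exists v' : 'rV[R[i]]_2,
    [/\ minimal_vector L v' /\ consecutive L v v',
        detC u v = 1 ->
          lex_minimal (E1 u v w1) v' /\
          (forall z, lex_minimal (E1 u v w1) z ->
             [/\ minimal_vector L z, consecutive L v z &
                 forall a g, E1_param w1 a g -> z = E1_vec u v a g ->
                 forall w1' w2', pair_form v z w1' w2' <->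
                   w1' = g - a / w1 /\ w2' = 1 / (g - a * w2)])
      & detC u v = 1 + 'i ->
          lex_minimal (E2 u v w1) v' /\
          (forall z, lex_minimal (E2 u v w1) z ->
             [/\ minimal_vector L z, consecutive L v z &
                 forall g, E2_param w1 g -> z = E2_vec u v g ->
                 forall w1' w2', pair_form v z w1' w2' <->
                   w1' = g - 1 / ((1 + 'i) * w1) - 1 / (1 + 'i) /\
                   w2' = 1 / (g - 1 / (1 + 'i) * w2 - 1 / (1 + 'i))])].
Proof.
(* Since x / 0 = 0, the hypothesis on [w1] excludes u_1 = 0 as well as v_1 = 0. *)
have u0 : u 0 0 != 0.
  by apply/eqP => h; apply: hw1n0; rewrite hw1 h invr0 mulr0.
have v0 : v 0 0 != 0.
  by apply/eqP => h; apply: hw1n0; rewrite hw1 h mul0r.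
have v1 : v 0 1 != 0.
  rewrite -sqn_gt0; have := sqn_ge0 (u 0 1); have := consecutive_lt1 huv; lra.
have n0 := addr1i_neq0 R.
have hv : minimal_vector L v by case: huv.
(* Both formulas for w_1' and w_2' come from writing z as (k v_1, l v_2); l is nonzero because |z_2|
   > |v_2|. *)
have form z : next L v z -> forall w1' w2' k l,
    z 0 0 = v 0 0 * k -> z 0 1 = v 0 1 * l ->
    pair_form v z w1' w2' <-> w1' = k /\ w2' = 1 / l.
  move=> /(next_consecutive hv)[_ _ hz] w1' w2' k l zk zl.
  have z1 : z 0 1 != 0 by rewrite -sqn_gt0; have := sqn_ge0 (v 0 1); lra.
  have l0 : l != 0 by apply: contraNneq z1 => l0; rewrite zl l0 mulr0.
  rewrite /pair_form zk zl; split=> [[h1 h2]|[-> ->]].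
    split; first exact/esym/(mulfI v0).
    apply: (mulfI v1); apply: (mulfI l0).
    by rewrite mulrA [l * _]mulrC -h2; field.
  by split=> //; field.
have nextP z : next L v z -> minimal_vector L z /\ consecutive L v z.
  by move=> /(next_consecutive hv)[].
have [h1|h1] := EM (detC u v = 1).
  have [z0 Ez0 z0min] := E1_lex_prec hL huv v0 h1.
  rewrite -hw1 in Ez0.
  have [] := next_lex_minimal (E := E1 u v w1) _ Ez0 z0min.
    by move=> z; rewrite hw1; apply: E1_below.
  move=> nz0 lz0 hz; exists z0; split; first exact: nextP.
    move=> _; split=> // z /hz nz; have [mz cz] := nextP _ nz; split=> //.
    move=> a g _ zE w1' w2'; apply: form => //; rewrite zE /E1_vec !mxE.
      by rewrite hw1; field; rewrite u0.
    by rewrite hw2; field.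
  move=> h2; exfalso; move: h2; rewrite h1 => /(congr1 (@complex.Im R)).
  by rewrite !ReImE; lra.
have [h2|h2] := EM (detC u v = 1 + 'i).
  have [z0 Ez0 z0min] := E2_lex_prec hL huv v0 h2.
  rewrite -hw1 in Ez0.
  have [] := next_lex_minimal (E := E2 u v w1) _ Ez0 z0min.
    by move=> z; rewrite hw1; apply: E2_below.
  move=> nz0 lz0 hz; exists z0; split; first exact: nextP.
    by move=> /h1.
  move=> _; split=> // z /hz nz; have [mz cz] := nextP _ nz; split=> //.
  move=> g _ zE w1' w2'; apply: form => //; rewrite zE /E2_vec !mxE.
    by rewrite hw1; field; rewrite u0 v0 n0.
  by rewrite hw2; field; rewrite v1 n0.
(* For any other determinant only the existence of a consecutive minimal vector remains. *)
have [s hs] := next_exists hL (below_nonempty hL huv v0).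
by exists s; split=> //; exact: nextP.
Qed.
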